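(* Let $B=(V,E)$ be a generalized Bratteli diagram with path space $X_B$, tail equivalence relation $\mathcal R$ and stochastic incidence matrices $(F_n)_{n\ge0}$. Then the set $M_1(\mathcal R)$ of all probability tail invariant measures on $X_B$ is identified with the inverse limit of the sets $(\Delta_1^{(n)},F_n^T)$: $$M_1(\mathcal R)=\varprojlim_{n\to\infty}(\Delta_1^{(n)},F_n^T),$$ where $\mu\in M_1(\mathcal R)$ is identified with the sequence $(\overline q^{(n)})_{n\ge0}$ of vectors $\overline q^{(n)}=\langle \mu(X_w^{(n)}): w\in V_n\rangle\in\Delta_1^{(n)}$, which satisfies $F_n^T\overline q^{(n+1)}=\overline q^{(n)}$ for all $n\ge0$.
   Context: The term ''measure'' always means a non-atomic positive Borel measure. A generalized Bratteli diagram $B=(V,E)$ is a graded graph with $V=\bigsqcup_{n\ge0}V_n$, $E=\bigsqcup_{n\ge 0}E_n$, where every $V_n$ is countably infinite, every $E_n$ is countable, and there are range and source maps $r,s$ with $r(E_n)=V_{n+1}$, $s(E_n)=V_n$, such that $s^{-1}(v)\ne\emptyset$ for all $v\in V$, $r^{-1}(v)\neq\emptyset$ for all $v\in V\setminus V_0$, and $r^{-1}(v)$ is finite for all $v\in V\setminus V_0$. The path space $X_B$ is the set of infinite paths $x=(x_n)_{n\ge0}$, $x_n\in E_n$, $s(x_{n+1})=r(x_n)$, with topology generated by the cylinder sets $[\overline e]$ of infinite paths extending a finite path $\overline e$ starting in $V_0$. Two infinite paths are tail equivalent (relation $\mathcal R$) if they coincide from some level on. A measure $\mu$ on $X_B$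 is tail invariant if $\mu([\overline e])=\mu([\overline e'])$ for any two cylinder sets with $r(\overline e)=r(\overline e')$. For $w\in V_n$, $X_w^{(n)}=\{x=(x_i)\in X_B: s(x_n)=w\}$. For $v\in V_{n+1}$, $w\in V_n$ let $f'^{(n)}_{vw}$ be the number of edges between $w$ and $v$. Put $H^{(0)}_v=1$ for $v\in V_0$ and $H^{(n+1)}_v=\sum_{w\in V_n}f'^{(n)}_{vw}H^{(n)}_w$ (the number of finite paths from $V_0$ to $v$). The stochastic incidence matrix is $F_n=(f^{(n)}_{vw})$, $f^{(n)}_{vw}=f'^{(n)}_{vw}H^{(n)}_w/H^{(n+1)}_v$, $v\in V_{n+1}$, $w\in V_n$. $\Delta_1^{(n)}=\{\langle x_w\rangle_{w\in V_n}:x_w\ge0,\sum_w x_w=1\}$, and $(F_n^T\overline x)_w=\sum_{v\in V_{n+1}}f^{(n)}_{vw}x_v$. The inverse limit $\varprojlim(\Delta_1^{(n)},F_n^T)$ is the set of all sequences $(\overline q^{(n)})_{n\ge0}$ with $\overline q^{(n)}\in\Delta_1^{(n)}$ and $F_n^T\overline q^{(n+1)}=\overline q^{(n)}$ for all $n\ge0$.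
   Formalization: Probability tail invariant measures are allowed to have atoms, although the paper's convention is that measures are non-atomic; with that convention the identification fails, e.g. for V_n = E_n = N with s = r = id, where M_1(R) is empty but the inverse limit is not. *)

(* Defs.v *)
From HB Require Import structures.
From mathcomp Require Import all_boot all_order all_algebra finmap.
From mathcomp Require Import all_classical all_reals all_analysis.

Set Implicit Arguments.
Unset Strict Implicit.
Unset Printing Implicit Defensive.
Import Order.TTheory GRing.Theory Num.Theory.

Local Open Scope classical_set_scope.
Local Open Scope ring_scope.

(* The vertex set is the disjoint union of the [gbd_V n], the edge set that of
   the [gbd_E n].  The last two axioms on [gbd_s], [gbd_r] imply
   s(E_n) = V_n and r(E_n) = V_(n+1). *)
Record gbd : Type := Gbd {
  gbd_V : nat -> choiceType ;
  gbd_E : nat -> choiceType ;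
  gbd_s : forall n, gbd_E n -> gbd_V n ;
  gbd_r : forall n, gbd_E n -> gbd_V n.+1 ;
  gbd_V_countable : forall n, countable [set: gbd_V n] ;
  gbd_V_infinite : forall n, infinite_set [set: gbd_V n] ;
  gbd_E_countable : forall n, countable [set: gbd_E n] ;
  gbd_r_finite : forall n (v : gbd_V n.+1),
    finite_set [set e : gbd_E n | gbd_r e = v] ;
  gbd_s_neq0 : forall n (v : gbd_V n), [set e : gbd_E n | gbd_s e = v] !=set0 ;
  gbd_r_neq0 : forall n (v : gbd_V n.+1), [set e : gbd_E n | gbd_r e = v] !=set0
}.

Record path_space (B : gbd) : Type := Path {
  path_edge :> forall n, gbd_E B n ;
  path_edgeP : forall n, gbd_s (path_edge n.+1) = gbd_r (path_edge n)
}.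

Lemma path_space_nonempty (B : gbd) : exists x : path_space B, True.
Proof.
have [v0 _] := infinite_setN0 (@gbd_V_infinite B 0).
pose next n (v : gbd_V B n) := projT1 (cid (gbd_s_neq0 v)).
have nextP n (v : gbd_V B n) : gbd_s (next n v) = v by exact: projT2 (cid (gbd_s_neq0 v)).
pose v_ := fix v_ n : gbd_V B n :=
  if n is m.+1 then gbd_r (next m (v_ m)) else v0.
have xP n : gbd_s (next n.+1 (v_ n.+1)) = gbd_r (next n (v_ n)).
  by rewrite nextP.
by exists (Path xP).
Qed.

HB.instance Definition _ (B : gbd) := gen_eqMixin (path_space B).
HB.instance Definition _ (B : gbd) := gen_choiceMixin (path_space B).
HB.instance Definition _ (B : gbd) :=
  isPointed.Build (path_space B) (projT1 (cid (path_space_nonempty B))).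

(* [fpath B n w]: finite paths (e_0, ..., e_(n-1)) from V_0 to w \in V_n; for
   n = 0 the only one is the empty path at w. *)
Inductive fpath (B : gbd) : forall n, gbd_V B n -> Type :=
| fpath_nil (v : gbd_V B 0) : fpath v
| fpath_rcons n (e : gbd_E B n) : fpath (gbd_s e) -> fpath (gbd_r e).

Fixpoint cylinder (B : gbd) n (w : gbd_V B n) (p : fpath w) :
    set (path_space B) :=
  match p with
  | fpath_nil v => [set x | gbd_s (x 0%N) = v]
  | @fpath_rcons _ n e p' => cylinder p' `&` [set x | x n = e]
  end.

Definition cylinders (B : gbd) : set (set (path_space B)) :=
  [set A | exists n (w : gbd_V B n) (p : fpath w), A = cylinder p].

HB.instance Definition _ (B : gbd) :=
  isSubBaseTopological.Build (path_space B) (@cylinders B) id.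

Definition borel_path (B : gbd) := g_sigma_algebraType (@open (path_space B)).

Definition tail_invariant (R : realType) (B : gbd)
    (mu : set (path_space B) -> \bar R) : Prop :=
  forall n (w : gbd_V B n) (p p' : fpath w),
    mu (cylinder p) = mu (cylinder p').

(* Atoms are allowed: in the diagram with V_n = E_n = nat and s = r = id the
   path space is countable, so every probability has atoms, while the inverse
   limit is not empty. *)
Definition invariant_probabilities (R : realType) (B : gbd) :
    set (probability (borel_path B) R) := [set mu | tail_invariant mu].

Definition vertex_set (B : gbd) n (w : gbd_V B n) : set (path_space B) :=
  [set x | gbd_s (x n) = w].

Definition incidence (B : gbd) n (v : gbd_V B n.+1) (w : gbd_V B n) : nat :=
  #|` fset_set [set e : gbd_E B n | gbd_s e = w /\ gbd_r e = v] |.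

(* The sum has finite support, since r^-1(v) is finite. *)
Fixpoint height (B : gbd) n : gbd_V B n -> nat :=
  if n is m.+1 then
    fun v => \sum_(w \in [set: gbd_V B m]) (incidence v w * height w)%N
  else fun=> 1%N.

Definition stochastic_incidence (R : realType) (B : gbd) n
    (v : gbd_V B n.+1) (w : gbd_V B n) : R :=
  (incidence v w)%:R * (height w)%:R / (height v)%:R.

Definition Delta1 (R : realType) (B : gbd) n : set (gbd_V B n -> R) :=
  [set x | (forall w, 0 <= x w) /\
           (\esum_(w in [set: gbd_V B n]) (x w)%:E = 1)%E].

(* F_n^T x, for x with nonnegative entries. *)
Definition stochastic_trmul (R : realType) (B : gbd) n
    (x : gbd_V B n.+1 -> R) (w : gbd_V B n) : \bar R :=
  \esum_(v in [set: gbd_V B n.+1]) (stochastic_incidence R v w * x v)%:E.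

Definition inverse_limit (R : realType) (B : gbd) :
    set (forall n, gbd_V B n -> R) :=
  [set q : forall n, gbd_V B n -> R | (forall n, Delta1 (q n)) /\
           (forall n w, stochastic_trmul (q n.+1) w = (q n w)%:E)].

Definition vertex_vectors (R : realType) (B : gbd)
    (mu : probability (borel_path B) R) (n : nat) (w : gbd_V B n) : R :=
  fine (mu (vertex_set w)).

(* Main.v *)
Require Import Defs.
From HB Require Import structures.
From mathcomp Require Import all_boot all_order all_algebra finmap.
From mathcomp Require Import all_classical all_reals all_analysis.

(** Why the correspondence holds.  If mu is tail invariant, all the cylinders
    that end at a vertex w have the same measure c.  There are height w of them
    and they partition the paths through w, so mu (vertex_set w) is
    c * height w: the vertex vectors determine the values of mu on cylinders,
    and conversely.  This is [measure_height], which is proved for any part A of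
    [vertex_set w] that meets all the cylinders ending at w in the same measure,
    because the induction needs it for the paths that follow a given edge.  The
    two consequences are:
    - the paths through w and then v have measure f_vw * mu (vertex_set v)
      ([stochastic_incidenceM]), so that summing over v gives the compatibility
      F_n^T q_(n+1) = q_n;
    - two tail invariant probabilities with the same vertex vectors agree on
      cylinders, which, together with the empty set and the whole space, are
      stable under intersection and generate the Borel sets; hence they are
      equal.

    For existence, q in the inverse limit prescribes the value
    [mass q w] = q_n(w) / height w for each cylinder that ends at w, and the
    compatibility says that this value is the sum of the masses of the
    one-edge extensions ([mass_edges]).  No compactness is at hand to turn
    this additive function on cylinders into a measure, since a vertex may have
    infinitely many outgoing edges.  Instead, the unit interval is subdivided:
    [0, 1[ is tiled by half-open intervals of lengths [mass q v], v in V_0, then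
    the interval of a finite path is tiled by the intervals of its one-edge
    extensions, and so on.  Consecutive half-open intervals of lengths a_0, a_1,
    ..., with a finite sum c, cover [0, c[ exactly, without remainder
    ([interval_tiling]), so each point of [0, 1[ lies in the intervals of the
    prefixes of exactly one infinite path ([coding_path]).  The image of
    Lebesgue measure under this coding gives each cylinder the length of its
    interval, as prescribed. *)

Set Implicit Arguments.
Unset Strict Implicit.
Unset Printing Implicit Defensive.
Import Order.TTheory GRing.Theory Num.Theory.

Local Open Scope classical_set_scope.
Local Open Scope ring_scope.

(* [fpath] is also a notation for the orbits of a function. *)
Local Notation fpath := Defs.fpath.

(** * Sums and unions over countable index sets *)

Lemma esumZl (R : realType) (T : choiceType) (D : set T) (a : T -> \bar R) r :
  0 < r -> (forall i, D i -> (0 <= a i)%E) ->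
  (\esum_(i in D) (r%:E * a i) = r%:E * \esum_(i in D) a i)%E.
Proof.
move=> r0 a0; rewrite /esum -ereal_sup_pZl//; congr ereal_sup.
rewrite image_comp; apply: eq_imagel => A [finA AD] /=.
rewrite !fsbig_finite//= !big_seq ge0_sume_distrr// => i.
by rewrite in_fset_set// inE => /AD/a0.
Qed.

Lemma subset_esum (R : realType) (T : choiceType) (D D' : set T)
    (a : T -> \bar R) : D `<=` D' ->
  (\esum_(i in D) a i <= \esum_(i in D') a i)%E.
Proof.
move=> DD'; apply: ge_ereal_sup => _ [A [finA AD] <-].
by apply: esum_ge; exists A => //; split => //; exact: subset_trans DD'.
Qed.

Lemma esum_fiber (R : realType) (T U : choiceType) (h : T -> U) (D : set T)
    (a : T -> \bar R) : (forall i, D i -> (0 <= a i)%E) ->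
  \esum_(i in D) a i =
  \esum_(u in [set: U]) \esum_(i in D `&` [set i | h i = u]) a i.
Proof.
move=> a0; rewrite esum_esum; last by move=> u i _ [/a0].
rewrite (reindex_esum D _ (fun i => (h i, i)))//; split.
- by move=> i Di /=; split.
- by move=> i j _ _ [].
- by move=> [u i] [/= _ [Di <-]]; exists i.
Qed.


(** Countable additivity is available for sequences of sets; this turns a family
    indexed by a countable set into a sequence [G], restricted to the codes of
    the indices. *)
Lemma countable_bigcup_reindex (T : Type) (I : choiceType) (D : set I)
    (F : I -> set T) : countable D ->
  exists (f : I -> nat) (G : nat -> set T), [/\ set_inj D f,
    \bigcup_(i in D) F i = \bigcup_(k in f @` D) G k &
    forall i, D i -> G (f i) = F i].
Proof.
move=> /countable_injP[f finj]; exists f.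
pose G k := \bigcup_(i in D `&` [set i | f i = k]) F i.
have GE i : D i -> G (f i) = F i.
  move=> Di; apply/seteqP; split=> [x [j [Dj fji]]|x Fx]; last by exists i.
  by rewrite (finj j i) ?inE.
exists G; split => //; rewrite bigcup_image.
by apply: eq_bigcupr => i Di; rewrite GE.
Qed.

Lemma countable_bigcup_measurable d (T : measurableType d) (I : choiceType)
    (D : set I) (F : I -> set T) :
  countable D -> (forall i, D i -> measurable (F i)) ->
  measurable (\bigcup_(i in D) F i).
Proof.
move=> /(countable_bigcup_reindex F)[f [G [_ -> GE]]] mF.
by apply: bigcup_measurable => _ [i Di <-]; rewrite GE//; exact: mF.
Qed.

Lemma measure_countable_bigcup d (T : measurableType d) (R : realType)
    (mu : {measure set T -> \bar R}) (I : choiceType) (D : set I)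
    (F : I -> set T) :
  countable D -> (forall i, D i -> measurable (F i)) -> trivIset D F ->
  mu (\bigcup_(i in D) F i) = \esum_(i in D) mu (F i).
Proof.
move=> /(countable_bigcup_reindex F)[f [G [finj -> GE]]] mF tF.
rewrite measure_bigcup; first last.
- move=> _ _ [i Di <-] [j Dj <-]; rewrite !GE// => FF; congr (f _); exact: tF.
- by move=> _ [i Di <-]; rewrite GE//; exact: mF.
rewrite nneseries_esum// set_mem_set esum_image//.
by apply: eq_esum => i Di; rewrite GE.
Qed.

(** * Tilings of an interval *)

(** The intervals [off t, off t + f t[ for t in D partition [0, c[; those of
    length 0 are empty, but are still located inside [0, c]. *)
Definition tiles_interval (R : realType) (T : Type) (D : set T)
    (f off : T -> R) (c : R) : Prop :=
  [/\ forall t, D t -> 0 <= off t,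
      forall t, D t -> off t + f t <= c,
      forall x, 0 <= x < c -> exists2 t, D t & off t <= x < off t + f t &
      forall t u x, D t -> D u ->
        off t <= x < off t + f t -> off u <= x < off u + f u -> t = u].

(** With the indices enumerated, put the intervals one after the other, each
    starting where the previous one ends.  A point x < c is below some partial
    sum of the lengths, and the first such partial sum tells in which interval x
    lies: since the intervals are half-open, no point is left out, whatever the
    order of the indices. *)
Lemma interval_tiling (R : realType) (T : choiceType) (D : set T)
    (f : T -> R) (c : R) :
  countable D -> (forall t, D t -> 0 <= f t) ->
  (\esum_(t in D) (f t)%:E = c%:E)%E ->
  exists off, tiles_interval D f off c.
Proof.
move=> /countable_injP[code cinj] f0 fc.
(* E k is the sum of the lengths of the indices with a code below k; the
   interval of t is [E (code t), E (code t + 1)[. *)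
pose E k := \esum_(t in D `&` [set t | (code t < k)%N]) (f t)%:E.
have f0' t : D t -> (0 <= (f t)%:E)%E by rewrite lee_fin; exact: f0.
have E0 k : (0 <= E k)%E by apply: esum_ge0 => t [/f0'].
have Ec k : (E k <= c%:E)%E.
  by rewrite -fc; apply: subset_esum => //; exact: subIsetl.
have Efin k : E k \is a fin_num.
  by rewrite ge0_fin_numE// (le_lt_trans (Ec k))// ltry.
have ES t : D t -> E (code t).+1 = (E (code t) + (f t)%:E)%E.
  move=> Dt; rewrite /E (esumID [set t]); last by move=> u [/f0'].
  rewrite addeC; congr (_ + _)%E.
    congr esum; apply/seteqP; split=> u /=.
      move=> [[Du]]; rewrite ltnS leq_eqVlt => /orP[/eqP cu|//] ut.
      by exfalso; apply: ut; apply: cinj; rewrite ?inE.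
    by move=> [Du ut]; split; [split => //; exact: ltnW|move=> tu; rewrite tu ltnn in ut].
  rewrite (_ : _ `&` _ = [set t]) ?esum_set1//; first exact: f0'.
  by apply/seteqP; split=> u /=; [case|move=> ->].
have E1 k : (forall t, D t -> code t <> k) -> E k.+1 = E k.
  move=> Dk; congr esum; apply/seteqP; split=> u /= [Du].
    by rewrite ltnS leq_eqVlt => /orP[/eqP/Dk|].
  by move=> uk; split => //; exact: ltnW.
have Emono k l : (k <= l)%N -> (E k <= E l)%E.
  move=> kl; apply: subset_esum => t [Dt tk].
  by split => //=; exact: leq_trans kl.
have EE t : D t -> ((fine (E (code t)) + f t)%:E = E (code t).+1)%E.
  by move=> Dt; rewrite EFinD fineK// ES.
exists (fun t => fine (E (code t))); split.
- by move=> t _; rewrite fine_ge0.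
- by move=> t Dt; rewrite -lee_fin EE.
- move=> x /andP[x0 xc].
  have [k xk] : exists k, (x%:E < E k)%E.
    have : (x%:E < \esum_(t in D) (f t)%:E)%E by rewrite fc lte_fin.
    move=> /ereal_sup_gt[_ [A [finA AD] <-]] xA.
    exists (\max_(t <- fset_set A) code t).+1; apply: (lt_le_trans xA).
    apply: esum_ge; exists A => //; split => // t At; split; first exact: AD.
    by rewrite /= ltnS leq_bigmax_seq// in_fset_set// inE.
  have [k' xk' k'P] := ex_minnP (ex_intro (fun k => (x%:E < E k)%E) k xk).
  case: k' => [|k'] in xk' k'P *.
    move: xk'; rewrite /E (_ : _ `&` _ = set0) ?esum_set0 ?lte_fin ?ltNge ?x0//.
    by apply/seteqP; split=> t //= -[].
  have [[t [Dt tk]]|nt] := pselect (exists t, D t /\ code t = k').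
    exists t => //; rewrite -lee_fin -lte_fin EE// fineK// tk xk' andbT.
    by rewrite leNgt; apply/negP => /k'P; rewrite ltnn.
  have : (x%:E < E k')%E.
    by rewrite -E1// => t Dt tk; apply: nt; exists t.
  by move=> /k'P; rewrite ltnn.
- have H t u x : D t -> D u -> fine (E (code t)) <= x < fine (E (code t)) + f t ->
      fine (E (code u)) <= x < fine (E (code u)) + f u -> (code t <= code u)%N.
    move=> Dt Du /andP[tx _] /andP[_ xu]; rewrite leqNgt; apply/negP => ut.
    move: tx xu.
    rewrite -lee_fin -lte_fin EE// fineK// => tx xu.
    by have := le_lt_trans tx xu; rewrite ltNge Emono.
  move=> t u x Dt Du xt xu; apply: cinj; rewrite ?inE//.
  by apply/eqP; rewrite eqn_leq (H _ _ x)//= (H _ _ x).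
Qed.

(** * Cylinders and the Borel sets of the path space *)

Lemma fpath_nonempty (B : gbd) n (w : gbd_V B n) : exists p : fpath w, True.
Proof.
elim: n w => [|n IHn] w; first by exists (fpath_nil w).
have [e <-] := gbd_r_neq0 w.
by have [p _] := IHn (gbd_s e); exists (fpath_rcons p).
Qed.

Lemma path_prefix (B : gbd) (x : path_space B) n :
  exists p : fpath (gbd_s (x n)), cylinder p x.
Proof.
elim: n => [|n [p px]]; first by exists (fpath_nil (gbd_s (x 0%N))).
by rewrite path_edgeP; exists (fpath_rcons p).
Qed.

Lemma cylinder_sub_vertex_set (B : gbd) n (w : gbd_V B n) (p : fpath w) :
  cylinder p `<=` vertex_set w.
Proof. by case: p => [v x //|m e p x [_ /= xe]]; rewrite /vertex_set/= path_edgeP xe. Qed.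

(** Elements of a cylinder of length n are compared by their first n edges, which
    avoids comparing two finite paths whose types depend on their ranges.  The
    condition on the first vertex matters only for n = 0. *)
Lemma cylinder_agree (B : gbd) n (w : gbd_V B n) (p : fpath w) x y :
  cylinder p x ->
  cylinder p y <-> gbd_s (y 0%N) = gbd_s (x 0%N) /\
                   forall i, (i < n)%N -> y i = x i.
Proof.
elim: p => {n w} [v /= ->|n e p IHp /= [px xe]]; first by split=> [->|[]].
split=> [[/(IHp px)[yx0 yx] ye]|[yx0 yx]].
  split=> // i; rewrite ltnS leq_eqVlt => /orP[/eqP ->|/yx//].
  by rewrite xe ye.
by rewrite yx//; split=> //; apply/(IHp px); split=> // i /ltnW; exact: yx.
Qed.

Lemma cylinder_subset (B : gbd) m n (v : gbd_V B m) (w : gbd_V B n)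
    (p : fpath v) (p' : fpath w) x : (m <= n)%N ->
  cylinder p x -> cylinder p' x -> cylinder p' `<=` cylinder p.
Proof.
move=> mn px p'x y /(cylinder_agree _ p'x)[yx0 yx].
by apply/(cylinder_agree _ px); split=> // i im; apply: yx; exact: leq_trans mn.
Qed.

(** A pi-system: cylinders are nested or disjoint, so only the empty set has to
    be added; the whole space is the countable cover of finite measure that
    uniqueness of measures asks for. *)
Definition cylinder_system (B : gbd) : set (set (path_space B)) :=
  @cylinders B `|` [set set0; setT].

Lemma cylinder_system_setI (B : gbd) : setI_closed (@cylinder_system B).
Proof.
move=> _ _ [[m [v [p ->]]]|[->|->]] [[n [w [p' ->]]]|[->|->]];
  rewrite ?(set0I, setI0, setTI, setIT); do ?[by right; left|by right; right].
- have [[x [px p'x]]|/nonemptyPn ->] := pselect (cylinder p `&` cylinder p' !=set0);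
    last by right; left.
  left; have [mn|/ltnW nm] := leqP m n.
    by exists n, w, p'; apply/setIidr/(cylinder_subset mn px p'x).
  by exists m, v, p; apply/setIidl/(cylinder_subset nm p'x px).
- by left; exists m, v, p.
- by left; exists n, w, p'.
Qed.

Lemma cylinders_countable (B : gbd) : countable (@cylinders B).
Proof.
(* C n is a set that contains the cylinders of length n, defined by recursion on
   n so that countability is immediate. *)
pose C := fix C n : set (set (path_space B)) :=
  if n is m.+1 then
    [set Ae.1 `&` [set x | x m = Ae.2] | Ae in C m `*` [set: gbd_E B m]]
  else [set [set x : path_space B | gbd_s (x 0%N) = v] | v in [set: gbd_V B 0]].
have cylC n (w : gbd_V B n) (p : fpath w) : C n (cylinder p).
  elim: p => {n w} [v|n e p IHp] /=; first by exists v.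
  by exists (cylinder p, e).
have cC n : countable (C n).
  elim: n => [|n IHn] /=; apply: (card_le_trans (card_image_le _ _)).
    exact: gbd_V_countable.
  by apply: countableX => //; exact: gbd_E_countable.
apply: (@sub_countable _ _ _ (\bigcup_n C n)); last exact: bigcup_countable.
by apply: subset_card_le => _ [n [w [p ->]]]; exists n.
Qed.

Lemma open_cylinder (B : gbd) n (w : gbd_V B n) (p : fpath w) :
  open (cylinder p).
Proof.
have cp : @cylinders B (cylinder p) by exists n, w, p.
exists [set cylinder p]; last by rewrite bigcup_set1.
by move=> _ ->; exact: (finI_from1 id).
Qed.

(** An open set is a union of finite intersections of cylinders.  There are only
    countably many of these, so the union is a countable one. *)
Lemma measurable_pathE (B : gbd) :
  (measurable : set (set (borel_path B))) = <<s @cylinder_system B >>.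
Proof.
apply/seteqP; split.
- apply: smallest_sub; first exact: smallest_sigma_algebra.
  move=> _ [D DC <-].
  apply: (@countable_bigcup_measurable _ (g_sigma_algebraType (@cylinder_system B)) _ D id).
    apply: (sub_countable (subset_card_le DC)).
    exact: finI_from_countable (@cylinders_countable B).
  move=> A /DC[D' D'C <-]; apply: fin_bigcap_measurable => // C /D'C/set_mem C'.
  by apply: sub_sigma_algebra; left.
- apply: smallest_sub; first exact: sigma_algebra_measurable.
  move=> _ [[n [w [p ->]]]|[->|->]]; [|exact: measurable0|exact: measurableT].
  by apply: sub_sigma_algebra; exact: open_cylinder.
Qed.

Section path_sets.
Variable B : gbd.
Implicit Types n : nat.

Definition edge_set n (e : gbd_E B n) : set (path_space B) := [set x | x n = e].

Lemma measurable_cylinder n (w : gbd_V B n) (p : fpath w) :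
  measurable (cylinder p : set (borel_path B)).
Proof. by apply: sub_sigma_algebra; exact: open_cylinder. Qed.

(** A path with n-th edge e has a prefix that ends with e, hence the set is a union
    of cylinders, which are countably many. *)
Lemma measurable_edge_set n (e : gbd_E B n) :
  measurable (edge_set e : set (borel_path B)).
Proof.
rewrite (_ : edge_set e =
    \bigcup_(C in @cylinders B `&` [set C | C `<=` edge_set e]) C).
  apply: (@countable_bigcup_measurable _ (borel_path B) _ _ id).
    by apply: sub_countable (@cylinders_countable B); apply: subset_card_le; exact: subIsetl.
  by move=> _ [[m [w [p ->]]] _]; exact: measurable_cylinder.
apply/seteqP; split=> [x xe|x [C [_ Ce] /Ce//]].
have [p px] := path_prefix x n.
exists (cylinder (fpath_rcons p)) => //; split; last by rewrite -xe => y [].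
by exists n.+1, (gbd_r (x n)), (fpath_rcons p).
Qed.

Lemma vertex_set_source n (w : gbd_V B n) :
  vertex_set w = \bigcup_(e in [set e | gbd_s e = w]) edge_set e.
Proof.
by apply/seteqP; split=> [x xw|x [e /= ew xe]]; [exists (x n)|rewrite /vertex_set/= xe].
Qed.

Lemma vertex_set_range n (v : gbd_V B n.+1) :
  vertex_set v = \bigcup_(e in [set e | gbd_r e = v]) edge_set e.
Proof.
apply/seteqP; split=> [x|x [e /= ev xe]]; rewrite /vertex_set/= path_edgeP.
  by exists (x n).
by rewrite xe.
Qed.

Lemma edge_countable n (D : set (gbd_E B n)) : countable D.
Proof. by apply: sub_countable (@gbd_E_countable B n); exact: subset_card_le. Qed.

Lemma vertex_countable n (D : set (gbd_V B n)) : countable D.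
Proof. by apply: sub_countable (@gbd_V_countable B n); exact: subset_card_le. Qed.

Lemma measurable_vertex_set n (w : gbd_V B n) :
  measurable (vertex_set w : set (borel_path B)).
Proof.
rewrite vertex_set_source; apply: countable_bigcup_measurable => [|e _].
  exact: edge_countable.
exact: measurable_edge_set.
Qed.

Lemma trivIset_edge_set n (D : set (gbd_E B n)) : trivIset D (@edge_set n).
Proof. by move=> e e' _ _ [x [<- <-]]. Qed.

Lemma trivIset_vertex_set n (D : set (gbd_V B n)) : trivIset D (@vertex_set B n).
Proof. by move=> v v' _ _ [x [<- <-]]. Qed.

(** The sum over w that defines the height counts the edges from w to v in bulk;
    here they are taken one by one, as in a partition of the finite paths that
    end at v according to their last edge. *)
Lemma height_succ n (v : gbd_V B n.+1) :
  height v = \sum_(e \in [set e | gbd_r e = v]) height (gbd_s e).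
Proof.
set D := [set e | gbd_r e = v].
have finD : finite_set D by exact: gbd_r_finite.
pose A := fset_set D.
rewrite [RHS]fsbig_finite//= (partition_big_imfset _ (@gbd_s B n))/=.
rewrite -(fsbig_widen [set` [fset gbd_s e | e in A]%fset])//=; last first.
  move=> w [_ wA]; rewrite /= (_ : incidence v w = 0%N) ?mul0n//.
  rewrite /incidence (_ : [set e | _] = set0) ?fset_set0//.
  apply/seteqP; split=> e // [ew ev]; apply: wA => /=.
  by apply/imfsetP; exists e => //=; rewrite in_fset_set// inE.
rewrite -fsbig_seq//; apply: eq_bigr => w _.
rewrite (eq_bigr (fun=> height w)) => [|e /eqP -> //].
rewrite big_const_seq iter_addn_0 mulnC; congr (_ * _)%N.
rewrite -size_filter; apply: perm_size.
have finwv : finite_set [set e | gbd_s e = w /\ gbd_r e = v].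
  by apply: sub_finite_set finD => e [].
apply: uniq_perm => [||e]; first exact: fset_uniq.
  exact: (filter_uniq _ (fset_uniq _)).
by rewrite mem_filter !in_fset_set//; apply/idP/andP; rewrite !inE => -[/eqP].
Qed.

Lemma height_gt0 n (w : gbd_V B n) : (0 < height w)%N.
Proof.
elim: n w => [//|n IHn] w; rewrite height_succ.
have [e ew] := gbd_r_neq0 w.
have finD := @gbd_r_finite B n w.
rewrite fsbig_finite//= lt0n sum_nat_seq_neq0; apply/hasP; exists e.
  by rewrite in_fset_set// inE.
by rewrite -lt0n IHn.
Qed.

(** * Tail invariant measures *)

Section invariant_measure.
Variables (R : realType) (mu : {measure set (borel_path B) -> \bar R}).

(** A splits into its intersections with the [height w] cylinders that end at w.
    Rather than enumerating them, split A according to the edge e that enters w: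
    a cylinder ending at the source of e meets that part of A in the same set
    as its extension by e does, so the induction hypothesis applies with the
    same constant c, and [height_succ] adds up the heights. *)
Lemma measure_height n (w : gbd_V B n) (A : set (borel_path B)) (c : R) :
  measurable A -> A `<=` vertex_set w ->
  (forall p : fpath w, mu (cylinder p `&` A) = c%:E) ->
  mu A = (c *+ height w)%:E.
Proof.
elim: n w A => [|n IHn] w A mA Aw muA.
  by rewrite mulr1n -(muA (fpath_nil w)); congr (mu _); apply/esym/setIidr.
have muAe e : gbd_r e = w ->
    mu (A `&` edge_set e) = (c *+ height (gbd_s e))%:E.
  move=> ew; apply: IHn.
  - by apply: measurableI => //; exact: measurable_edge_set.
  - by move=> x [_ /= xe]; rewrite /vertex_set/= xe.
  - subst w => p; rewrite -(muA (fpath_rcons p)); congr (mu _).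
    by rewrite setICA setIC -setIA.
have finw := @gbd_r_finite B n w.
rewrite -{1}(setIidl Aw) vertex_set_range setI_bigcupr measure_fin_bigcup//.
- rewrite height_succ (eq_fsbigr (fun e => (c *+ height (gbd_s e))%:E)).
    rewrite fsumEFin// !fsbig_finite//= -sumrMnr//.
  by move=> e /set_mem/muAe.
- by apply: trivIset_setIl; exact: trivIset_edge_set.
- by move=> e _; apply: measurableI => //; exact: measurable_edge_set.
Qed.

End invariant_measure.
End path_sets.

Section invariant_probability.
Variables (R : realType) (B : gbd) (mu : probability (borel_path B) R).
Hypothesis muI : tail_invariant mu.

Lemma cylinder_fin_num n (w : gbd_V B n) (p : fpath w) :
  mu (cylinder p) \is a fin_num.
Proof. by apply: fin_num_measure; exact: measurable_cylinder. Qed.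

Lemma vertex_vectorsE n (w : gbd_V B n) :
  (vertex_vectors mu w)%:E = mu (vertex_set w).
Proof. by rewrite fineK// fin_num_measure//; exact: measurable_vertex_set. Qed.

Lemma vertex_vectors_height n (w : gbd_V B n) (p : fpath w) :
  vertex_vectors mu w = fine (mu (cylinder p)) * (height w)%:R.
Proof.
apply: EFin_inj; rewrite vertex_vectorsE mulr_natr.
apply: measure_height => [|//|p']; first exact: measurable_vertex_set.
rewrite (setIidl (@cylinder_sub_vertex_set _ _ _ _)) fineK ?cylinder_fin_num//.
exact: muI.
Qed.

(** The paths through e are those of [height (gbd_s e)] cylinders that end at the
    range of e, and invariance gives all of these the measure of any other one,
    whether or not its last edge is e. *)
Lemma edge_set_height n (e : gbd_E B n) (p : fpath (gbd_r e)) :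
  mu (edge_set e) = (fine (mu (cylinder p)) * (height (gbd_s e))%:R)%:E.
Proof.
rewrite mulr_natr; apply: measure_height; first exact: measurable_edge_set.
  by move=> x xe; rewrite /vertex_set/= xe.
by move=> p'; rewrite fineK ?cylinder_fin_num//; exact: (muI (fpath_rcons p') p).
Qed.

(** This is what the stochastic normalisation is for: with c the common measure
    of the cylinders that end at v, there are (incidence v w) * (height w) of
    them whose last edge leaves w, among (height v) of them in all. *)
Lemma stochastic_incidenceM n (w : gbd_V B n) (v : gbd_V B n.+1) :
  (stochastic_incidence R v w * vertex_vectors mu v)%:E =
  mu (vertex_set w `&` vertex_set v).
Proof.
pose D := [set e : gbd_E B n | gbd_s e = w /\ gbd_r e = v].
have finD : finite_set D by apply: sub_finite_set (gbd_r_finite v) => e [].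
have [p _] := fpath_nonempty v.
have -> : vertex_set w `&` vertex_set v = \bigcup_(e in D) edge_set e.
  rewrite /vertex_set; apply/seteqP; split=> [x [/= xw]|x [e [/= <- <-] <-]].
    by rewrite path_edgeP => xv; exists (x n).
  by split => //=; rewrite path_edgeP.
rewrite [RHS]measure_fin_bigcup//; last 2 first.
- exact: trivIset_edge_set.
- by move=> e _; exact: measurable_edge_set.
rewrite (eq_fsbigr (fun=> (fine (mu (cylinder p)) * (height w)%:R)%:E)); last first.
  move=> e /set_mem[<- ev]; move: p; rewrite -ev => p; exact: edge_set_height.
rewrite fsumEFin// fsbig_finite//= big_const_seq count_predT iter_addr_0.
congr EFin.
rewrite (vertex_vectors_height p) /stochastic_incidence /incidence.
have Hv : (height v)%:R != 0 :> R by rewrite pnatr_eq0 -lt0n height_gt0.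
by rewrite mulrCA divfK// -[RHS]mulr_natl mulrCA.
Qed.

Lemma inverse_limit_vertex_vectors : inverse_limit (vertex_vectors mu).
Proof.
split=> [n|n w]; first split=> [w|].
- exact: fine_ge0.
- rewrite (eq_esum (b := fun w => mu (vertex_set w))) => [|w _]; last first.
    exact: vertex_vectorsE.
  rewrite -measure_countable_bigcup; last 3 first.
  - exact: vertex_countable.
  - by move=> w _; exact: measurable_vertex_set.
  - exact: trivIset_vertex_set.
  rewrite -[RHS](probability_setT mu); congr (mu _).
  by apply/seteqP; split=> // x _; exists (gbd_s (x n)).
- rewrite /stochastic_trmul vertex_vectorsE.
  under eq_esum do rewrite stochastic_incidenceM.
  rewrite -measure_countable_bigcup; last 3 first.
  - exact: vertex_countable.
  - by move=> v _; apply: measurableI; exact: measurable_vertex_set.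
  - by apply: trivIset_setIl; exact: trivIset_vertex_set.
  rewrite -setI_bigcupr; congr (mu _); apply/setIidl => x _.
  by exists (gbd_s (x n.+1)).
Qed.

End invariant_probability.

(** On a cylinder that ends at w, both measures are the w-entry of the vertex vector
    divided by [height w]. *)
Lemma tail_invariant_unique (R : realType) (B : gbd)
    (mu nu : probability (borel_path B) R) :
  tail_invariant mu -> tail_invariant nu ->
  vertex_vectors mu = vertex_vectors nu ->
  forall A : set (borel_path B), measurable A -> mu A = nu A.
Proof.
move=> muI nuI munu A.
apply: (@measure_unique _ R (borel_path B) (@cylinder_system B) (fun=> setT) _ _ _ _ mu nu).
- exact: measurable_pathE.
- exact: cylinder_system_setI.
- by move=> _; right; right.
- exact: bigcup_const.
- move=> _ [[n [w [p ->]]]|[->|->]]; last 2 first.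
  + by rewrite !measure0.
  + by rewrite [LHS]probability_setT [RHS]probability_setT.
  suff : mu (cylinder p) = nu (cylinder p) by [].
  rewrite -(fineK (cylinder_fin_num mu p)) -(fineK (cylinder_fin_num nu p)).
  have Hw : (height w)%:R != 0 :> R by rewrite pnatr_eq0 -lt0n height_gt0.
  congr EFin; apply: (mulIf Hw).
  by rewrite -(vertex_vectors_height muI) -(vertex_vectors_height nuI) munu.
- by move=> _; rewrite [X in (X < _)%E]probability_setT ltry.
Qed.

(** * Coding points of the unit interval by infinite paths *)

Section existence.
Variables (R : realType) (B : gbd) (q : forall n, gbd_V B n -> R).
Hypothesis qlim : inverse_limit q.

(** The measure that a cylinder ending at w has to have. *)
Definition mass n (w : gbd_V B n) : R := q w / (height w)%:R.

Lemma mass_ge0 n (w : gbd_V B n) : 0 <= mass w.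
Proof. by rewrite divr_ge0//; have [/(_ n)[]] := qlim. Qed.

(** The compatibility F_n^T q_(n+1) = q_n, divided by [height w]: in F_n^T the edges
    from w to v are grouped, and each of them contributes
    (height w) * (mass v). *)
Lemma mass_edges n (w : gbd_V B n) :
  (\esum_(e in [set e | gbd_s e = w]) (mass (gbd_r e))%:E = (mass w)%:E)%E.
Proof.
have Hw : 0 < (height w)%:R :> R by rewrite ltr0n height_gt0.
have m0 (e : gbd_E B n) : (0 <= (mass (gbd_r e))%:E)%E by rewrite lee_fin mass_ge0.
rewrite (esum_fiber (@gbd_r B n))//.
(* Clear the denominator [height w]. *)
suff : ((height w)%:R%:E *
    (\esum_(v in [set: gbd_V B n.+1])
      \esum_(e in [set e | gbd_s e = w] `&` [set e | gbd_r e = v])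
        (mass (gbd_r e))%:E) = (q w)%:E)%E.
  move=> /(congr1 (fun z => ((height w)%:R^-1%:E * z)%E)).
  rewrite muleA -!EFinM mulVf ?lt0r_neq0// mul1e => ->.
  by rewrite mulrC.
have [_ <-] := qlim; rewrite -esumZl//; last by move=> v _; exact: esum_ge0.
apply: eq_esum => v _.
set D := _ `&` _.
have finD : finite_set D by apply: sub_finite_set (gbd_r_finite v) => e [].
rewrite (eq_esum (b := fun=> (mass v)%:E)) => [|e [_ /= ->] //].
rewrite -{1}(set_mem_set D) esum_fset ?set_mem_set//; last by move=> *; rewrite lee_fin mass_ge0.
rewrite fsumEFin// fsbig_finite//= big_const_seq count_predT iter_addr_0.
rewrite -EFinM -[mass v *+ _]mulr_natl /stochastic_incidence /mass /incidence.
by congr EFin; rewrite mulrCA -!mulrA; congr (_ * (_ * _)); exact: mulrC.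
Qed.

Lemma mass_roots : (\esum_(v in [set: gbd_V B 0]) (mass v)%:E = 1%:E)%E.
Proof.
have [/(_ 0%N)[_ <-] _] := qlim.
by apply: eq_esum => v _; rewrite /mass /= divr1.
Qed.

Lemma edge_tiling n : exists off : gbd_E B n -> R,
  forall w, tiles_interval [set e | gbd_s e = w] (@mass n.+1 \o @gbd_r B n) off (mass w).
Proof.
have off_ (w : gbd_V B n) := interval_tiling
  (edge_countable [set e | gbd_s e = w])
  (fun e _ => mass_ge0 (gbd_r e)) (mass_edges w).
have [off offP] := choice off_.
exists (fun e => off (gbd_s e) e) => w.
have [off0 off1 offE offU] := offP w.
split=> [e /= ew|e /= ew|x /offE[e /= <- xe]|e e' x /= ew e'w]; rewrite ?ew ?e'w.
- exact: off0.
- exact: off1.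
- by exists e.
- exact: offU.
Qed.

Section intervals.
Variables (root_off : gbd_V B 0 -> R) (edge_off : forall n, gbd_E B n -> R).

(** The interval of p is [left_end p, left_end p + mass w[. *)
Fixpoint left_end n (w : gbd_V B n) (p : fpath w) : R :=
  match p with
  | Defs.fpath_nil v => root_off v
  | @Defs.fpath_rcons _ n e p' => left_end p' + edge_off e
  end.

Hypotheses
  (root_tiles : tiles_interval [set: gbd_V B 0] (@mass 0) root_off 1)
  (edge_tiles : forall n (w : gbd_V B n), tiles_interval
    [set e | gbd_s e = w] (@mass n.+1 \o @gbd_r B n) (@edge_off n) (mass w)).

Lemma interval_le n (w : gbd_V B n) (p : fpath w) :
  0 <= left_end p /\ left_end p + mass w <= 1.
Proof.
elim: p => {n w} [v|n e p [p0 p1]] /=.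
  by have [/(_ v I) ? /(_ v I) ? _ _] := root_tiles.
have [/(_ e erefl) e0 /(_ e erefl) e1 _ _] := edge_tiles (gbd_s e).
split; first by rewrite addr_ge0.
by rewrite -addrA (le_trans _ p1)// lerD2l.
Qed.

(** The path is built edge by edge, always choosing the edge whose interval
    contains x; by uniqueness in each tiling, a finite path whose interval
    contains x must make the same choices. *)
Lemma coding_path x : 0 <= x < 1 -> exists y : path_space B,
  forall n (w : gbd_V B n) (p : fpath w),
    cylinder p y <-> left_end p <= x < left_end p + mass w.
Proof.
move=> x01.
(* A stage of the construction: the vertex that has been reached and the left end
   of the interval of the finite path that led to it.  The finite path itself
   is not recorded, so no transport along an equality of vertices occurs. *)
pose state n := {va : gbd_V B n * R | va.2 <= x < va.2 + mass va.1}.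
have [_ _ /(_ x x01)[v0 _ xv0] rootU] := root_tiles.
have nextE n (st : state n) : exists e : gbd_E B n,
    gbd_s e = (sval st).1 /\ (sval st).2 + edge_off e <= x
      < (sval st).2 + edge_off e + mass (gbd_r e).
  case: st => -[w a] /= xw.
  have : 0 <= x - a < mass w by rewrite subr_ge0 ltrBlDl.
  have [_ _ + _] := edge_tiles w; move=> /[apply] -[e /= ew xe]; exists e; split => //.
  by rewrite -lerBrDl -addrA -ltrBlDl.
pose e_ n st := sval (cid (@nextE n st)).
have e_P n st := svalP (cid (@nextE n st)).
pose st_ := fix st_ n : state n :=
  if n is m.+1 then
    exist (fun va : gbd_V B m.+1 * R => va.2 <= x < va.2 + mass va.1)
      (gbd_r (e_ m (st_ m)), (sval (st_ m)).2 + edge_off (e_ m (st_ m)))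
      (proj2 (e_P m (st_ m)))
  else exist (fun va : gbd_V B 0 * R => va.2 <= x < va.2 + mass va.1)
    (v0, root_off v0) xv0.
have yP n : gbd_s (e_ n.+1 (st_ n.+1)) = gbd_r (e_ n (st_ n)).
  by have [-> _] := e_P n.+1 (st_ n.+1).
pose y := Path yP; exists y.
pose a n := (sval (st_ n)).2.
have ys n : gbd_s (y n) = (sval (st_ n)).1 by have [] := e_P n (st_ n).
have xa n : a n <= x < a n + mass (gbd_s (y n)).
  by rewrite ys; exact: (svalP (st_ n)).
have aS n : a n.+1 = a n + edge_off (y n) by [].
have a0 : a 0%N = root_off (gbd_s (y 0%N)) by rewrite ys.
have cyl_left n (w : gbd_V B n) (p : fpath w) : cylinder p y -> a n = left_end p.
  by elim: p => {n w} [v /= <-//|n e p IHp /= [/IHp <- <-]].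
move=> n w p; split=> [py|].
  rewrite -(cyl_left _ _ _ py).
  by have /(_ y py) <- := @cylinder_sub_vertex_set _ _ _ p.
elim: p => {n w} [v|n e p IHp] /= xp.
  by apply: (rootU _ _ x) => //; rewrite -a0.
have [/(_ e erefl) e0 /(_ e erefl) /= e1 _ edgeU] := edge_tiles (gbd_s e).
have xp' : left_end p <= x < left_end p + mass (gbd_s e).
  case/andP: xp => xp1 xp2; apply/andP; split.
    by apply: le_trans xp1; rewrite lerDl.
  by apply: lt_le_trans xp2 _; rewrite -addrA lerD2l.
have py := IHp xp'; split => //.
have ye : gbd_s (y n) = gbd_s e by exact: (cylinder_sub_vertex_set py).
apply: (edgeU _ _ (x - left_end p)) => //=.
  have := xa n.+1; rewrite aS (cyl_left _ _ _ py) path_edgeP.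
  by rewrite lerBrDl -addrA -ltrBlDl.
by move: xp; rewrite lerBrDl -addrA -ltrBlDl.
Qed.

End intervals.

End existence.

(** * Existence of the measure *)

Section unit_interval_image.
Context d (T : measurableType d) (R : realType) (phi : measurableTypeR R -> T).
Hypothesis mphi : measurable_fun (`[0, 1[%classic : set (measurableTypeR R)) phi.

Let image_measure (A : set T) : \bar R :=
  lebesgue_measure (`[0, 1[%classic `&` phi @^-1` A).

Let measurable_image (A : set T) :
  measurable A -> measurable (`[0, 1[%classic `&` phi @^-1` A).
Proof. by apply: mphi; exact: measurable_itv. Qed.

Let image_measure0 : image_measure set0 = 0%E.
Proof. by rewrite /image_measure preimage_set0 setI0 measure0. Qed.

Let image_measure_ge0 A : (0 <= image_measure A)%E.
Proof. exact: measure_ge0. Qed.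

Let image_measure_sigma_additive : semi_sigma_additive image_measure.
Proof.
move=> F mF tF mUF; rewrite /image_measure preimage_bigcup setI_bigcupr.
apply: measure_semi_sigma_additive.
- by move=> n; exact: measurable_image.
- apply: trivIset_setIl; apply/trivIsetP => i j _ _ ij.
  by rewrite -preimage_setI; move/trivIsetP : tF => ->//; rewrite preimage_set0.
- by rewrite -setI_bigcupr -preimage_bigcup; exact: measurable_image.
Qed.

HB.instance Definition _ := isMeasure.Build _ _ _
  image_measure image_measure0 image_measure_ge0 image_measure_sigma_additive.

Let image_measure_setT : image_measure setT = 1%E.
Proof.
rewrite /image_measure preimage_setT setIT lebesgue_measure_itv/=.
by rewrite lte_fin ltr01 oppr0 adde0.
Qed.

HB.instance Definition _ :=
  Measure_isProbability.Build _ _ _ image_measure image_measure_setT.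

Lemma unit_interval_image_probability : exists mu : probability T R,
  forall A, mu A = lebesgue_measure (`[0, 1[%classic `&` phi @^-1` A).
Proof. by exists image_measure. Qed.

End unit_interval_image.

(** The image of Lebesgue measure under the coding.  The preimage of a cylinder is
    the interval of its finite path, whence both the measurability of the
    coding and the value of the measure. *)
Lemma inverse_limit_probability (R : realType) (B : gbd)
    (q : forall n, gbd_V B n -> R) : inverse_limit q ->
  exists mu : probability (borel_path B) R,
    forall n (w : gbd_V B n) (p : fpath w), mu (cylinder p) = (mass q w)%:E.
Proof.
move=> qlim.
have [root_off rootP] := interval_tiling (@gbd_V_countable B 0)
  (fun v _ => mass_ge0 qlim v) (mass_roots qlim).
pose edge_off n := sval (cid (edge_tiling qlim n)).
have edgeP n : forall w, tiles_interval _ _ (edge_off n) _ :=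
  svalP (cid (edge_tiling qlim n)).
pose left n (w : gbd_V B n) (p : fpath w) := left_end root_off edge_off p.
have phi_ex (x : R) : exists y : path_space B, 0 <= x < 1 ->
    forall n (w : gbd_V B n) (p : fpath w),
      cylinder p y <-> left n w p <= x < left n w p + mass q w.
  have [x01|x01] := boolP (0 <= x < 1); last by exists point.
  by have [y yP] := coding_path rootP edgeP x01; exists y.
have [phi phiP] := choice phi_ex.
have phi_cyl n (w : gbd_V B n) (p : fpath w) :
    `[0, 1[%classic `&` phi @^-1` (cylinder p) =
    `[left n w p, left n w p + mass q w[%classic.
  have [p0 p1] := interval_le rootP edgeP p.
  apply/seteqP; split=> x /=; rewrite !in_itv/=; first by move=> [/phiP ->].
  move=> xp; have x01 : 0 <= x < 1.
    case/andP: xp => px xp.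
    by rewrite (le_trans p0 px) (lt_le_trans xp p1).
  by split => //; apply/phiP.
have mphi : @measurable_fun _ _ (measurableTypeR R) (borel_path B) `[0, 1[%classic phi.
  apply: (@measurability _ _ (measurableTypeR R) (borel_path B) _ phi (@cylinder_system B)).
    exact: measurable_pathE.
  move=> _ [_ [[n [w [p ->]]]|[->|->]] <-].
  - by rewrite phi_cyl; exact: measurable_itv.
  - by rewrite preimage_set0 setI0; exact: measurable0.
  - by rewrite preimage_setT setIT; exact: measurable_itv.
have [mu muE] := unit_interval_image_probability mphi.
exists mu => n w p; rewrite muE phi_cyl lebesgue_measure_itv/= lte_fin.
have [_|] := ltP; first by rewrite -EFinB addrAC subrr add0r.
(* Otherwise the interval is empty, which happens only for a mass of 0. *)
rewrite gerDl => m0; congr EFin; apply/eqP.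
by rewrite eq_le (mass_ge0 qlim).
Qed.

Theorem corollary4p1 (R : realType) (B : gbd) :
  (forall mu : probability (borel_path B) R,
    invariant_probabilities mu -> inverse_limit (vertex_vectors mu)) /\
  (forall mu nu : probability (borel_path B) R,
    invariant_probabilities mu -> invariant_probabilities nu ->
    vertex_vectors mu = vertex_vectors nu ->
    forall A : set (borel_path B), measurable A -> mu A = nu A) /\
  (forall q : forall n, gbd_V B n -> R,
    inverse_limit q ->
    exists mu : probability (borel_path B) R,
      invariant_probabilities mu /\ vertex_vectors mu = q).
Proof.
split; first by move=> mu; exact: inverse_limit_vertex_vectors.
split; first by move=> mu nu; exact: tail_invariant_unique.
move=> q qlim; have [mu muE] := inverse_limit_probability qlim.
have muI : tail_invariant mu by move=> n w p p'; rewrite !muE.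
exists mu; split=> //; apply: functional_extensionality_dep => n; apply/funext => w.
have [p _] := fpath_nonempty w.
rewrite (vertex_vectors_height muI p) muE /= divfK//.
by rewrite pnatr_eq0 -lt0n height_gt0.
Qed.
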